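(* Let $G=(V_G,E_G)$ be a $D_G$-regular graph and $H=(V_H,E_H)$ be a $D_H$-regular graph. Let $x_1,x_2\in V_G$ and $y_1,y_2\in V_H$ with $d(x_1,x_2)$ and $d(y_1,y_2)$ finite and $(x_1,y_1)\neq(x_2,y_2)$. Then $$\kappa^{G\times H}_{LLY}((x_1,y_1),(x_2,y_2)) = \frac{D_G\, d(x_1,x_2)\,\kappa^G_{LLY}(x_1,x_2)+D_H\, d(y_1,y_2)\,\kappa^H_{LLY}(y_1,y_2)}{(D_G+D_H)\,(d(x_1,x_2)+d(y_1,y_2))}.$$ Furthermore, for all $p\in[\frac12,1)$, $$\kappa^{G\times H}_{p}((x_1,y_1),(x_2,y_2)) = \frac{D_G\, d(x_1,x_2)\,\kappa^G_{p}(x_1,x_2)+D_H\, d(y_1,y_2)\,\kappa^H_{p}(y_1,y_2)}{(D_G+D_H)\,(d(x_1,x_2)+d(y_1,y_2))}.$$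
   Context: Graphs are locally finite and have no multiple edges and no self loops. $d_v$ denotes the degree of the vertex $v$, $w\sim v$ means that $w$ and $v$ are adjacent, and $d(v,w)$ is the combinatorial distance (length of a shortest path) in the relevant graph. For a graph with vertex set $V$, $v\in V$ and $p\in[0,1]$, $\mu_v^p$ is the probability measure on $V$ with $\mu_v^p(v)=p$, $\mu_v^p(z)=\frac{1-p}{d_v}$ if $z\sim v$, and $\mu_v^p(z)=0$ otherwise. For probability measures $\mu_1,\mu_2$ on $V$, the Wasserstein distance is $W_1(\mu_1,\mu_2)=\inf_{\pi}\sum_{v\in V}\sum_{w\in V} d(v,w)\pi(v,w)$, the infimum over all $\pi:V\times V\to[0,1]$ with $\mu_1(v)=\sum_{w}\pi(v,w)$ and $\mu_2(w)=\sum_{v}\pi(v,w)$. For $v\ne w$ the $p$-Ollivier-Ricci curvature is $\kappa_p(v,w)=1-\frac{W_1(\mu_v^p,\mu_w^p)}{d(v,w)}$ and the Lin-Lu-Yau curvature is $\kappa_{LLY}(v,w)=\lim_{p\to1}\frac{\kappa_p(v,w)}{1-p}$; a superscript ($G$, $H$, $G\times H$) indicates the graph in which the curvature is computed. $G\times H$ is the Cartesian product: vertex set $V_G\times V_H$, with $(w_1,z_1)\sim(w_2,z_2)$ iff either $w_1=w_2$ and $z_1\sim z_2$ in $H$, or $w_1\sim w_2$ in $G$ and $z_1=z_2$. Convention: the term $d(x_1,x_2)\kappa^G(x_1,x_2)$ is read as $0$ if $x_1=x_2$, and $d(y_1,y_2)\kappa^H(y_1,y_2)$ is read as $0$ if $y_1=y_2$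 (for both $\kappa_{LLY}$ and $\kappa_p$). *)

(* Defs.v *)
From HB Require Import structures.
From mathcomp Require Import all_boot all_order all_algebra finmap.
From mathcomp Require Import all_classical all_reals all_analysis.

Set Implicit Arguments.
Unset Strict Implicit.
Unset Printing Implicit Defensive.

Import Order.TTheory GRing.Theory Num.Theory.
Import numFieldNormedType.Exports.

Local Open Scope classical_set_scope.
Local Open Scope ring_scope.

Record graph (V : choiceType) := Graph {
  adj : rel V;
  adj_sym : symmetric adj;
  adj_irr : irreflexive adj;
  adj_finite : forall v, finite_set [set w | adj v w]
}.

Section Graphs.
Variables (V : choiceType) (G : graph V).

Definition degree (v : V) : nat := #|` fset_set [set w | adj G v w]|%fset.

Definition regular (D : nat) : Prop := forall v, degree v = D.

(* [v :: s] is a walk from [v] to [last v s] with [size s] edges; the distance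
   is [+oo] when there is no walk from [v] to [w]. *)
Definition dist (R : realType) (v w : V) : \bar R :=
  ereal_inf [set (size s)%:R%:E
            | s in [set s : seq V | path (adj G) v s /\ last v s = w]].

End Graphs.

Section CartesianProduct.
Variables (VG VH : choiceType) (G : graph VG) (H : graph VH).

Definition cart_adj : rel (VG * VH)%type := fun u v =>
  ((u.1 == v.1) && adj H u.2 v.2) || (adj G u.1 v.1 && (u.2 == v.2)).

Lemma cart_adj_sym : symmetric cart_adj.
Proof.
move=> u v; rewrite /cart_adj (eq_sym u.1) (eq_sym u.2).
by rewrite (adj_sym G) (adj_sym H).
Qed.

Lemma cart_adj_irr : irreflexive cart_adj.
Proof. by move=> u; rewrite /cart_adj (adj_irr G) (adj_irr H) andbF. Qed.

Lemma cart_adj_finite u : finite_set [set v | cart_adj u v].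
Proof.
apply: (@sub_finite_set _ _ (([set u.1] `*` [set z | adj H u.2 z]) `|`
                             ([set w | adj G u.1 w] `*` [set u.2]))).
  move=> [w z]; rewrite /cart_adj /=.
  by case/orP => /andP[]; [move=> /eqP <- ?; left | move=> ? /eqP <-; right].
rewrite finite_setU; split; apply: finite_setX => //.
- exact: adj_finite.
- exact: adj_finite.
Qed.

Definition cart : graph (VG * VH)%type :=
  Graph cart_adj_sym cart_adj_irr cart_adj_finite.

End CartesianProduct.

Section Curvature.
Variables (R : realType) (V : choiceType) (G : graph V).

(* A probability measure on the discrete space [V] is represented by its point
   masses. *)
Definition mu (p : R) (v z : V) : R :=
  if z == v then p else if adj G v z then (1 - p) / (degree G v)%:R else 0.

Definition coupling (mu1 mu2 : V -> R) : set (V -> V -> R) :=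
  [set pi : V -> V -> R |
    [/\ forall v w, 0 <= pi v w <= 1,
        forall v, (mu1 v)%:E = \esum_(w in [set: V]) (pi v w)%:E &
        forall w, (mu2 w)%:E = \esum_(v in [set: V]) (pi v w)%:E]].

(* Distances may be infinite; [+oo * 0 = 0] in [\bar R], so pairs of vertices
   carrying no mass do not contribute to the cost. *)
Definition transport_cost (pi : V -> V -> R) : \bar R :=
  \esum_(v in [set: V]) \esum_(w in [set: V]) (dist G R v w * (pi v w)%:E)%E.

Definition W1 (mu1 mu2 : V -> R) : \bar R :=
  ereal_inf [set transport_cost pi | pi in coupling mu1 mu2].

(* Meaningful for [v != w] at finite distance, of positive degree, and
   [0 <= p <= 1], in which case [W1] is finite. *)
Definition kappa (p : R) (v w : V) : R :=
  1 - fine (W1 (mu p v) (mu p w)) / fine (dist G R v w).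

(* The limit is one-sided because [p] ranges over [0, 1]. *)
Definition kappaLLY (v w : V) : R :=
  lim (kappa p v w / (1 - p) @[p --> 1^'-]).

End Curvature.

(* Main.v *)
(** The proof is purely primal. For [D = DG + DH] the random walk measure of
    the product splits as
    [mu_(x,y) = (DG/D) mu_x (x) delta_y + (DH/D) delta_x (x) mu_y], so convexity
    of [W1] and product couplings give
    [D W1 <= DG (W1^G + d(y1,y2)) + DH (d(x1,x2) + W1^H)].
    Conversely, distances add in the product, so the cost of a coupling is the
    sum of the costs of its projections to the factors. The projection to [G]
    couples the lazier measures [(DG/D) mu_x + (DH/D) delta_x]; as [p >= 1/2],
    it must carry mass at least [DH/D] from [x1] to [x2], and removing that mass
    leaves a multiple of a coupling of [mu_x1] and [mu_x2]. The same argument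
    shows that [kappa_p / (1 - p)] is constant on [[1/2, 1)], so [kappaLLY] is
    twice the curvature at [p = 1/2]. *)
Require Import Defs.
From mathcomp Require Import all_boot all_order all_algebra finmap.
From mathcomp Require Import all_classical all_reals all_analysis.
From mathcomp Require Import ring lra.

Import Order.TTheory GRing.Theory Num.Theory.
Import numFieldNormedType.Exports.

Set Implicit Arguments.
Unset Strict Implicit.

Local Open Scope ring_scope.

(** * Nonnegative extended-real sums over arbitrary index sets *)

Section NonnegativeSums.
Local Open Scope classical_set_scope.
Local Open Scope ereal_scope.
Variable R : realType.
Implicit Types T U : choiceType.

Lemma esum_ge_term T (I : set T) (a : T -> \bar R) i :
  I i -> a i <= \esum_(j in I) a j.
Proof.
move=> Ii; apply: esum_ge; exists [set i]; last by rewrite fsbig_set1.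
by split; [exact: finite_set1 | move=> _ ->].
Qed.

Lemma esum_single T (a : T -> \bar R) t :
  0 <= a t -> (forall i, i != t -> a i = 0) -> \esum_(i in setT) a i = a t.
Proof.
move=> at0 a0; rewrite -[RHS](esum_set1 at0) [RHS]esum_mkcond.
apply: eq_esum => i _; case: ifPn => //; rewrite notin_setE => /= /eqP.
exact: a0.
Qed.

(** Only [<=] is proved directly, from finite subsums. For real [c > 0] the reverse follows by
    applying it with the constant inverse to [c]. *)
Lemma esumZl T (I : set T) (c : \bar R) (a : T -> \bar R) :
  0 <= c -> (forall i, 0 <= a i) ->
  \esum_(i in I) (c * a i) = c * \esum_(i in I) a i.
Proof.
move=> c0 a0.
have le_esumZ (k : \bar R) (b : T -> \bar R) : 0 <= k ->
    (forall i, 0 <= b i) ->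
    \esum_(i in I) (k * b i) <= k * \esum_(i in I) b i.
  move=> k0 b0; apply: ge_ereal_sup => _ [X [finX XI] <-].
  rewrite -ge0_mule_fsumr//.
  by apply: lee_wpmul2l => //; apply: ereal_sup_ubound; exists X.
apply/eqP; rewrite eq_le le_esumZ//=.
case: c c0 => [r| |//] r0.
- have [->|rn0] := eqVneq r 0%R.
    by rewrite mul0e esum_ge0// => i Ii; rewrite mul0e.
  have {}r0 : (0 < r)%R by rewrite lt_neqAle eq_sym rn0 -lee_fin.
  rewrite -lee_pdivlMl//.
  apply: le_trans (le_esumZ _ _ _ _).
  - by apply: le_esum => i Ii; rewrite muleA -EFinM mulVf// mul1e.
  - by rewrite lee_fin invr_ge0 ltW.
  - by move=> i; rewrite mule_ge0 ?a0// lee_fin ltW.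
(* For [c = +oo], one positive term makes the left-hand side infinite; otherwise every term is zero
   and so are both sides. *)
- have [[i [Ii ai]]|nai] := pselect (exists i, I i /\ 0 < a i).
    apply: le_trans (esum_ge_term _ Ii).
    by rewrite (gt0_mulye ai) leey.
  rewrite [X in _ * X]esum1 ?mule0 ?esum_ge0// => i Ii.
  - by rewrite mule_ge0 ?a0.
  - apply/eqP; rewrite eq_le a0// andbT leNgt; apply/negP => ai.
    by apply: nai; exists i.
Qed.

Lemma exchange_esum T U (I : set T) (J : set U) (a : T -> U -> \bar R) :
  (forall i j, 0 <= a i j) ->
  \esum_(i in I) \esum_(j in J) a i j = \esum_(j in J) \esum_(i in I) a i j.
Proof.
move=> a0; rewrite !esum_esum//.
rewrite (@reindex_esum _ _ _ (J `*`` fun=> I) _ (fun k => (k.2, k.1)))//.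
split=> [[x y] [] // | [x y] [x' y'] _ _ /= [-> ->] // | [x y] [/= Ix Jy]].
by exists (y, x).
Qed.

(** The pairs [(u, v)] with [f v = u] form the graph of [f], which [v] alone indexes. Keeping [u] as
    an argument of [a] lets a factor depending on the image leave the fiberwise sum. *)
Lemma esum_fiber T U (f : T -> U) (a : U -> T -> \bar R) :
  (forall u v, 0 <= a u v) ->
  \esum_(u in setT) \esum_(v in f @^-1` [set u]) a u v =
  \esum_(v in setT) a (f v) v.
Proof.
move=> a0; rewrite esum_esum//.
rewrite (@reindex_esum _ _ _ setT _ (fun v => (f v, v)))//.
split=> [v _ // | v w _ _ [] // | [u v] [_ /= <-]].
by exists v.
Qed.

Lemma esum_prod T U (a : T -> U -> \bar R) : (forall v w, 0 <= a v w) ->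
  \esum_(k in setT) a k.1 k.2 = \esum_(v in setT) \esum_(w in setT) a v w.
Proof.
move=> a0; rewrite esum_esum//; congr (esum _ _).
by apply/seteqP; split=> k //.
Qed.

Lemma esumM T U (a : T -> \bar R) (b : U -> \bar R) :
  (forall v, 0 <= a v) -> (forall w, 0 <= b w) ->
  \esum_(k in setT) (a k.1 * b k.2) =
  (\esum_(v in setT) a v) * (\esum_(w in setT) b w).
Proof.
move=> a0 b0; rewrite (@esum_prod T U (fun v w => a v * b w)); last first.
  by move=> v w; rewrite mule_ge0.
have Sb0 : 0 <= \esum_(w in setT) b w by exact: esum_ge0.
rewrite [RHS]muleC -esumZl//; apply: eq_esum => v _.
by rewrite esumZl// muleC.
Qed.

End NonnegativeSums.

(** * Point masses, couplings and the Wasserstein distance *)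

Definition point_mass (R : realType) (V : choiceType) (x v : V) : R :=
  (v == x)%:R.

Section Wasserstein.
Local Open Scope classical_set_scope.
Local Open Scope ereal_scope.
Variables (R : realType) (V : choiceType) (G : graph V).
Implicit Types (mu nu : V -> R) (pi : V -> V -> R) (x y v w : V).

Lemma dist_ge0 v w : 0 <= dist G R v w.
Proof. by apply: le_ereal_inf_tmp => _ [s _ <-]; rewrite lee_fin. Qed.

Lemma dist_refl v : dist G R v v = 0.
Proof.
apply/eqP; rewrite eq_le dist_ge0 andbT; apply: ereal_inf_lbound.
by exists [::].
Qed.

Lemma point_mass_ge0 x v : (0 <= point_mass R x v)%R.
Proof. by rewrite /point_mass. Qed.

Lemma esum_point_mass x (a : V -> \bar R) : 0 <= a x ->
  \esum_(v in setT) (a v * (point_mass R x v)%:E) = a x.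
Proof.
move=> ax0; rewrite (@esum_single _ _ _ x) /point_mass ?eqxx ?mule1// => v.
by move=> /negbTE->; rewrite mule0.
Qed.

Lemma esum_point_massZ x (c : R) : (0 <= c)%R ->
  \esum_(v in setT) (c * point_mass R x v)%:E = c%:E.
Proof.
move=> c0; under eq_esum do rewrite EFinM.
by rewrite (@esum_point_mass x (fun=> c%:E)).
Qed.

Lemma sum_point_mass x : \esum_(v in setT) (point_mass R x v)%:E = 1.
Proof.
rewrite -[RHS](@esum_point_massZ x 1%R)//.
by apply: eq_esum => v _; rewrite mul1r.
Qed.

Lemma transport_cost_ge0 pi : (forall v w, (0 <= pi v w)%R) ->
  0 <= transport_cost G pi.
Proof.
move=> pi0; apply: esum_ge0 => v _; apply: esum_ge0 => w _.
by rewrite mule_ge0 ?dist_ge0 ?lee_fin.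
Qed.

Lemma coupling_ge0 mu nu pi : coupling mu nu pi -> forall v w, (0 <= pi v w)%R.
Proof. by move=> [pi01 _ _] v w; case/andP: (pi01 v w). Qed.

(** An entry of [pi] is at most its row sum [mu v], which yields the bound by 1 in the definition of
    a coupling. *)
Lemma coupling_intro mu nu pi : (forall v w, (0 <= pi v w)%R) ->
  (forall v, (mu v <= 1)%R) ->
  (forall v, (mu v)%:E = \esum_(w in setT) (pi v w)%:E) ->
  (forall w, (nu w)%:E = \esum_(v in setT) (pi v w)%:E) ->
  coupling mu nu pi.
Proof.
move=> pi0 mu1 Emu Enu; split=> // v w; rewrite pi0 /= -lee_fin.
apply: (le_trans (esum_ge_term (fun w => (pi v w)%:E) (I : setT w))).
by rewrite -Emu lee_fin.
Qed.

Lemma W1_le_cost mu nu pi : coupling mu nu pi ->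
  W1 G mu nu <= transport_cost G pi.
Proof. by move=> pic; apply: ereal_inf_lbound; exists pi. Qed.

Lemma le_W1 mu nu c :
  (forall pi, coupling mu nu pi -> c <= transport_cost G pi) ->
  c <= W1 G mu nu.
Proof. by move=> h; apply: le_ereal_inf_tmp => _ [pi pic <-]; exact: h. Qed.

Lemma W1_ge0 mu nu : 0 <= W1 G mu nu.
Proof.
by apply: le_W1 => pi /coupling_ge0/transport_cost_ge0.
Qed.

Lemma W1_approx mu nu e : W1 G mu nu \is a fin_num -> (0 < e)%R ->
  exists2 pi, coupling mu nu pi & transport_cost G pi < W1 G mu nu + e%:E.
Proof.
move=> Wfin e0.
by have [_ [pi pic <-] lt] := lb_ereal_inf_adherent e0 Wfin; exists pi.
Qed.

Lemma transport_cost_lin (a b : R) pi1 pi2 : (0 <= a)%R -> (0 <= b)%R ->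
  (forall v w, (0 <= pi1 v w)%R) -> (forall v w, (0 <= pi2 v w)%R) ->
  transport_cost G (fun v w => a * pi1 v w + b * pi2 v w)%R =
  a%:E * transport_cost G pi1 + b%:E * transport_cost G pi2.
Proof.
move=> a0 b0 p1 p2.
have cost0 pi v w : (forall v w, (0 <= pi v w)%R) ->
    0 <= dist G R v w * (pi v w)%:E.
  by move=> ?; rewrite mule_ge0 ?dist_ge0 ?lee_fin.
rewrite /transport_cost -!esumZl ?lee_fin//;
  try by move=> v; apply: esum_ge0 => *; exact: cost0.
rewrite -esumD; try by move=> v _; rewrite mule_ge0 ?lee_fin//;
  apply: esum_ge0 => *; exact: cost0.
apply: eq_esum => v _.
rewrite -!esumZl ?lee_fin//; try by move=> w; exact: cost0.
rewrite -esumD; try by move=> w _; rewrite mule_ge0 ?lee_fin ?cost0.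
apply: eq_esum => w _.
rewrite EFinD !EFinM ge0_muleDr ?mule_ge0 ?lee_fin//.
by rewrite !(muleCA (dist _ _ _ _)).
Qed.

Lemma transport_cost_point_mass x y :
  transport_cost G (fun v w => point_mass R x v * point_mass R y w)%R =
  dist G R x y.
Proof.
rewrite /transport_cost (@esum_single _ _ _ x); last first.
- move=> v vx; apply: esum1 => w _.
  by rewrite /point_mass (negbTE vx) mul0r mule0.
- by apply: esum_ge0 => w _; rewrite mule_ge0 ?dist_ge0 ?lee_fin ?mulr_ge0.
under eq_esum do rewrite {1}/point_mass eqxx mul1r.
by rewrite esum_point_mass// dist_ge0.
Qed.

Lemma W1_point_mass x y :
  W1 G (point_mass R x) (point_mass R y) <= dist G R x y.
Proof.
rewrite -transport_cost_point_mass; apply: W1_le_cost; apply: coupling_intro.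
- by move=> v w; rewrite mulr_ge0 ?point_mass_ge0.
- by move=> v; rewrite /point_mass lern1 leq_b1.
- move=> v; by rewrite esum_point_massZ ?point_mass_ge0.
- move=> w; under eq_esum do rewrite mulrC.
  by rewrite esum_point_massZ ?point_mass_ge0.
Qed.

(** The same mixture of two near-optimal couplings couples the mixed measures, and the cost is
    linear in the coupling. *)
Lemma W1_mix (a b : R) mu1 mu2 nu1 nu2 :
  (0 <= a)%R -> (0 <= b)%R -> (a + b = 1)%R ->
  W1 G mu1 mu2 \is a fin_num -> W1 G nu1 nu2 \is a fin_num ->
  W1 G (fun v => a * mu1 v + b * nu1 v)%R (fun v => a * mu2 v + b * nu2 v)%R <=
  a%:E * W1 G mu1 mu2 + b%:E * W1 G nu1 nu2.
Proof.
move=> a0 b0 ab fmu fnu; apply/lee_addgt0Pr => e e0.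
have [pi1 c1 lt1] := W1_approx fmu e0.
have [pi2 c2 lt2] := W1_approx fnu e0.
have p1 := coupling_ge0 c1; have p2 := coupling_ge0 c2.
apply: (@le_trans _ _
  (transport_cost G (fun v w => a * pi1 v w + b * pi2 v w)%R)).
  apply: W1_le_cost.
  have [b1 r1 s1] := c1; have [b2 r2 s2] := c2.
  split=> [v w|v|w].
  - rewrite addr_ge0 ?mulr_ge0//= -[X in (_ <= X)%R]ab lerD// ler_piMr//.
      by case/andP: (b1 v w).
    by case/andP: (b2 v w).
  - under eq_esum do rewrite EFinD 2!EFinM.
    rewrite esumD ?esumZl; try by move=> *; rewrite ?mule_ge0 ?lee_fin.
    by rewrite -r1 -r2 EFinD 2!EFinM.
  - under eq_esum do rewrite EFinD 2!EFinM.
    rewrite esumD ?esumZl; try by move=> *; rewrite ?mule_ge0 ?lee_fin.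
    by rewrite -s1 -s2 EFinD 2!EFinM.
rewrite transport_cost_lin//.
apply: (@le_trans _ _
  (a%:E * (W1 G mu1 mu2 + e%:E) + b%:E * (W1 G nu1 nu2 + e%:E))).
  by apply: leeD; apply: lee_wpmul2l; rewrite ?lee_fin// ltW.
move: fmu fnu => /fineK <- /fineK <-.
rewrite -?(EFinD, EFinM) lee_fin le_eqVlt; apply/orP; left; apply/eqP.
by rewrite -[in RHS](mul1r e) -ab; ring.
Qed.

(* Since [mu1 x1 + mu2 x2 >= 1], every coupling moves mass at least [b] from
   [x1] to [x2]; removing that much leaves a coupling of [a mu1] and [a mu2]. *)
Lemma W1_lazy (a b : R) mu1 mu2 x1 x2 :
  (0 < a)%R -> (0 <= b)%R -> (a + b = 1)%R ->
  (forall v, (0 <= mu2 v)%R) -> (forall v, (mu1 v <= 1)%R) ->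
  \esum_(v in setT) (mu2 v)%:E = 1 -> (1 <= mu1 x1 + mu2 x2)%R ->
  b%:E * dist G R x1 x2 + a%:E * W1 G mu1 mu2 <=
  W1 G (fun v => a * mu1 v + b * point_mass R x1 v)%R
       (fun v => a * mu2 v + b * point_mass R x2 v)%R.
Proof.
move=> a0 b0 ab mu2_ge0 mu1_le1 mu2_sum mu12; apply: le_W1 => pi pic.
have pi0 := coupling_ge0 pic; have [_ row col] := pic.
have pm0 := point_mass_ge0; have a0' := ltW a0.
have b_le : (b <= pi x1 x2)%R.
  (* For [w != x2], the entry [pi x1 w] is at most the column sum [a * mu2 w]. Summing over [w]
     bounds row [x1], whose total is [a * mu1 x1 + b], by [pi x1 x2 + a * (1 - mu2 x2)]; hence [pi
     x1 x2 >= b + a * (mu1 x1 + mu2 x2 - 1)]. The extra term on the left avoids a subtraction in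
     [\bar R]. *)
  have : \esum_(w in setT) (pi x1 w + a * mu2 x2 * point_mass R x2 w)%:E <=
      \esum_(w in setT) (pi x1 x2 * point_mass R x2 w + a * mu2 w)%:E.
    apply: le_esum => w _; rewrite lee_fin /point_mass.
    have [->|wx2] := eqVneq w x2; first by rewrite !mulr1.
    rewrite !mulr0 addr0 add0r -lee_fin.
    have -> : (a * mu2 w)%:E = (a * mu2 w + b * point_mass R x2 w)%:E.
      by rewrite /point_mass (negbTE wx2) mulr0 addr0.
    by rewrite col; apply: esum_ge_term (fun v => (pi v w)%:E) _ _.
  under eq_esum do rewrite EFinD.
  under [X in _ <= X]eq_esum do rewrite EFinD [(a * _)%:E]EFinM.
  have amu0 : (0 <= a * mu2 x2)%R by rewrite mulr_ge0.
  rewrite !esumD; try by move=> *; rewrite ?mule_ge0 ?lee_fin ?mulr_ge0 ?pm0.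
  rewrite !esum_point_massZ//.
  rewrite esumZl ?lee_fin// mu2_sum -row.
  rewrite /point_mass eqxx -?(EFinD, EFinM) lee_fin.
  have : (a * 1 <= a * (mu1 x1 + mu2 x2))%R by rewrite ler_pM2l.
  by rewrite !mulr1 mulrDr; lra.
pose pi' v w := ((pi v w - b * (point_mass R x1 v * point_mass R x2 w)) / a)%R.
have pi'0 v w : (0 <= pi' v w)%R.
  rewrite divr_ge0 ?(ltW a0)// subr_ge0 /point_mass.
  have [->|] := eqVneq v x1; last by rewrite mul0r mulr0.
  by have [->|] := eqVneq w x2; rewrite ?mulr1// !mulr0.
have piE : pi = (fun v w =>
    a * pi' v w + b * (point_mass R x1 v * point_mass R x2 w))%R.
  apply/funext => v; apply/funext => w.
  by rewrite /pi' mulrCA divff ?gt_eqF// mulr1 subrK.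
clearbody pi'.
have pi'0E v w : 0 <= (pi' v w)%:E by rewrite lee_fin.
(* The marginals of [pi'] come from those of [pi] by cancelling the point mass and [a]. A sum [S] is
   not known to be finite beforehand, but since [a > 0] an infinite [S] would make a real number
   infinite. *)
have cancel_a (S : \bar R) (c e : R) :
    (a * c + b * e)%:E = a%:E * S + (b * e)%:E ->
    c%:E = S.
  case: S => [s| |].
  - by rewrite -EFinM -EFinD => -[] /addIr /(mulfI (lt0r_neq0 a0)) ->.
  - by rewrite gt0_muley ?lte_fin.
  - by rewrite gt0_muleNy ?lte_fin.
have pi'c : coupling mu1 mu2 pi'.
  apply: coupling_intro => //.
  - move=> v; apply: (cancel_a _ _ (point_mass R x1 v)); rewrite row piE.
    under eq_esum do rewrite EFinD EFinM mulrA.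
    rewrite esumD; try by move=> *; rewrite ?mule_ge0 ?lee_fin ?mulr_ge0 ?pm0.
    by rewrite esumZl ?lee_fin// esum_point_massZ ?mulr_ge0.
  - move=> w; apply: (cancel_a _ _ (point_mass R x2 w)); rewrite col piE.
    under eq_esum do rewrite EFinD EFinM (mulrC (point_mass _ _ _)) mulrA.
    rewrite esumD; try by move=> *; rewrite ?mule_ge0 ?lee_fin ?mulr_ge0 ?pm0.
    by rewrite esumZl ?lee_fin// esum_point_massZ ?mulr_ge0.
rewrite piE transport_cost_lin ?(ltW a0)//; last by move=> *; rewrite mulr_ge0.
rewrite transport_cost_point_mass addeC leeD2r// lee_wpmul2l ?lee_fin//.
exact: W1_le_cost.
Qed.

End Wasserstein.

(** * Pushing couplings forward along a map *)

Section Pushforward.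
Local Open Scope classical_set_scope.
Local Open Scope ereal_scope.
Variables (R : realType) (V U : choiceType) (G : graph U) (f : V -> U).

(** The image [S] of [pi] under [f] on both coordinates couples the image measures, and its cost is
    that of [pi] with distances measured between images. *)
Lemma W1_push (mu1 mu2 : V -> R) (nu1 nu2 : U -> R) (pi : V -> V -> R) :
  coupling mu1 mu2 pi -> (forall u, (nu1 u <= 1)%R) ->
  (forall u, (nu1 u)%:E = \esum_(v in f @^-1` [set u]) (mu1 v)%:E) ->
  (forall u, (nu2 u)%:E = \esum_(v in f @^-1` [set u]) (mu2 v)%:E) ->
  W1 G nu1 nu2 <= \esum_(v in setT) \esum_(w in setT)
                    (dist G R (f v) (f w) * (pi v w)%:E).
Proof.
move=> pic nu1_le1 nu1E nu2E.
have pi0 := coupling_ge0 pic; have [_ row col] := pic.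
have pi0E v w : 0 <= (pi v w)%:E by rewrite lee_fin.
pose S u u' := \esum_(v in f @^-1` [set u]) \esum_(w in f @^-1` [set u'])
                  (pi v w)%:E.
have S0 u u' : 0 <= S u u'.
  by apply: esum_ge0 => v _; apply: esum_ge0.
have fiberT (g : V -> \bar R) : (forall v, 0 <= g v) ->
    \esum_(u in setT) \esum_(v in f @^-1` [set u]) g v = \esum_(v in setT) g v.
  by move=> g0; rewrite (@esum_fiber _ _ _ f (fun=> g)).
have rowS u : \esum_(u' in setT) S u u' = (nu1 u)%:E.
  rewrite exchange_esum; last by move=> *; exact: esum_ge0.
  by rewrite nu1E; apply: eq_esum => v _; rewrite row fiberT.
have colS u' : \esum_(u in setT) S u u' = (nu2 u')%:E.
  rewrite fiberT; last by move=> *; exact: esum_ge0.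
  by rewrite exchange_esum// nu2E; apply: eq_esum => w _; rewrite col.
(* Couplings are real valued, so [S] must be finite before [fine] can be applied; its row sums
   [nu1 u] bound it. *)
have S_fin u u' : S u u' \is a fin_num.
  rewrite ge0_fin_numE//; apply: le_lt_trans (ltry (nu1 u)).
  by rewrite -rowS; exact: esum_ge_term.
have SE u u' : (fine (S u u'))%:E = S u u' by rewrite fineK.
apply: (@le_trans _ _ (transport_cost G (fun u u' => fine (S u u')))).
  apply: W1_le_cost; apply: coupling_intro => //.
  - by move=> u u'; rewrite fine_ge0.
  - by move=> u; rewrite -rowS; apply: eq_esum => u' _; rewrite SE.
  - by move=> u'; rewrite -colS; apply: eq_esum => u _; rewrite SE.
have d0 u u' v w : 0 <= dist G R u u' * (pi v w)%:E.
  by rewrite mule_ge0 ?dist_ge0.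
rewrite /transport_cost.
(* Group both coordinates of the right-hand side by fibers of [f]: on a pair of fibers the distance
   is constant and factors out, leaving [S]. *)
rewrite -(@esum_fiber _ _ _ f (fun u v =>
  \esum_(w in setT) (dist G R u (f w) * (pi v w)%:E))); last first.
  by move=> *; exact: esum_ge0.
rewrite le_eqVlt; apply/orP; left; apply/eqP; apply: eq_esum => u _.
under [RHS]eq_esum do
  rewrite -(@esum_fiber _ _ _ f (fun u' w => dist G R u u' * (pi _ w)%:E))//.
rewrite exchange_esum; last by move=> *; exact: esum_ge0.
apply: eq_esum => u' _; rewrite SE /S -esumZl ?dist_ge0//; last first.
  by move=> *; exact: esum_ge0.
by apply: eq_esum => v _; rewrite esumZl ?dist_ge0.
Qed.

End Pushforward.

(** * Shortest walks *)

Section Walks.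
Local Open Scope ereal_scope.
Variables (R : realType) (V : choiceType) (G : graph V).

Lemma dist_le_walk (v : V) s : path (adj G) v s ->
  dist G R v (last v s) <= (size s)%:R%:E.
Proof. by move=> ps; apply: ereal_inf_lbound; exists s. Qed.

(** Walk lengths are natural numbers, so the infimum is attained as soon as some walk exists; the
    infimum of the empty set is [+oo]. *)
Lemma dist_shortest_walk (v w : V) : dist G R v w = +oo \/
  exists s, [/\ path (adj G) v s, last v s = w &
                dist G R v w = (size s)%:R%:E].
Proof.
pose P n := `[< exists s, [/\ path (adj G) v s, last v s = w & size s = n] >].
have [exP|nexP] := pselect (exists n, P n).
  right; case: (ex_minnP exP) => n /asboolP [s [ps ls <-]] smin.
  exists s; split=> //; apply/eqP; rewrite eq_le; apply/andP; split.
    by rewrite -ls dist_le_walk.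
  apply: le_ereal_inf_tmp => _ [s' [ps' ls'] <-].
  by rewrite lee_fin ler_nat; apply: smin; apply/asboolP; exists s'.
left; rewrite /dist (_ : [set _ | _ in _]%classic = set0) ?ereal_inf0//.
apply/seteqP; split=> // x [s [ps ls] _]; apply: nexP.
by exists (size s); apply/asboolP; exists s.
Qed.

End Walks.

(** * Distance, degree and product couplings in the Cartesian product *)

Section CartesianProduct.
Local Open Scope classical_set_scope.
Local Open Scope ereal_scope.
Variables (R : realType) (VG VH : choiceType) (G : graph VG) (H : graph VH).

(** Each step of a product walk moves exactly one coordinate, so it is charged to exactly one of the
    two projected walks. *)
Lemma cart_walk_proj (u : VG * VH) s : path (adj (cart G H)) u s ->
  exists s1 s2, [/\ path (adj G) u.1 s1, path (adj H) u.2 s2,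
    last u.1 s1 = (last u s).1, last u.2 s2 = (last u s).2 &
    size s = (size s1 + size s2)%N].
Proof.
elim: s u => [|v s IH] u /=; first by exists [::], [::].
move=> /andP[uv /IH[s1 [s2 [p1 p2 l1 l2 ->]]]].
case/orP: uv => /andP[].
  by move=> /eqP-> uv; exists s1, (v.2 :: s2); rewrite /= uv addnS.
by move=> uv /eqP->; exists (v.1 :: s1), s2; rewrite /= uv.
Qed.

Lemma cart_walkl y (x : VG) s : path (adj G) x s ->
  path (adj (cart G H)) (x, y) [seq (z, y) | z <- s].
Proof.
elim: s x => //= z s IH x /andP[xz ps]; rewrite IH// andbT.
by rewrite /cart_adj /= xz eqxx orbT.
Qed.

Lemma cart_walkr x (y : VH) s : path (adj H) y s ->
  path (adj (cart G H)) (x, y) [seq (x, z) | z <- s].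
Proof.
elim: s y => //= z s IH y /andP[yz ps]; rewrite IH// andbT.
by rewrite /cart_adj /= yz eqxx.
Qed.

Lemma dist_cart (u v : VG * VH) :
  dist (cart G H) R u v = dist G R u.1 v.1 + dist H R u.2 v.2.
Proof.
apply/eqP; rewrite eq_le; apply/andP; split; last first.
  apply: le_ereal_inf_tmp.
  move=> _ [s [/cart_walk_proj[s1 [s2 [p1 p2 l1 l2 ->]]] <-] <-].
  by rewrite natrD EFinD -l1 -l2 leeD// dist_le_walk.
have Noo (W : choiceType) (K : graph W) a b : dist K R a b != -oo.
  by rewrite gt_eqF// (lt_le_trans _ (dist_ge0 _ _ _ _)).
have [->|[s1 [p1 l1 ->]]] := dist_shortest_walk R G u.1 v.1.
  by rewrite addye ?leey.
have [->|[s2 [p2 l2 ->]]] := dist_shortest_walk R H u.2 v.2.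
  by rewrite addey ?leey.
case: u v p1 l1 p2 l2 => [x1 y1] [x2 y2] /= p1 l1 p2 l2.
(* Walk first along [G] with second coordinate [y1], then along [H] with first coordinate [x2]. *)
have := @dist_le_walk R _ (cart G H) (x1, y1)
  ([seq (z, y1) | z <- s1] ++ [seq (x2, z) | z <- s2]).
rewrite cat_path last_cat size_cat !size_map natrD EFinD cart_walkl//=.
rewrite (last_map (fun z => (z, y1))) l1 (last_map (fun z => (x2, z))) l2.
by apply; exact: cart_walkr.
Qed.

Lemma degree_cart (u : VG * VH) :
  degree (cart G H) u = (degree G u.1 + degree H u.2)%N.
Proof.
have -> : degree (cart G H) u = #|` fset_set
   ((fun x => (x, u.2)) @` [set x | adj G u.1 x] `|`
    (fun y => (u.1, y)) @` [set y | adj H u.2 y])|%fset.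
  congr #|` fset_set _|%fset; apply/seteqP.
  split=> [[x y]|_ [[x ux <-]|[y uy <-]]].
  - rewrite /= /cart_adj /= => /orP[/andP[/eqP-> uy]|/andP[ux /eqP->]].
      by right; exists y.
    by left; exists x.
  - by rewrite /= /cart_adj /= ux eqxx orbT.
  - by rewrite /= /cart_adj /= uy eqxx.
have finG := adj_finite G u.1; have finH := adj_finite H u.2.
rewrite fset_setU ?fset_set_image//; try exact: finite_image.
rewrite cardfsU 2?card_imfset /=; try by move=> ? ? [].
rewrite (_ : (_ `&` _)%fset = fset0) ?cardfs0 ?subn0//.
apply/fsetP => z; rewrite !inE; apply/negbTE/negP => /andP[].
move=> /imfsetP[x /=]; rewrite in_fset_set// inE /= => ux ->.
move=> /imfsetP[y /= _ [xu _]].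
(* A neighbor of both kinds would make [u.1] adjacent to itself. *)
by rewrite xu adj_irr in ux.
Qed.

(** Product of near-optimal couplings: as distances add, its cost is the sum of the two costs, each
    weighted by the total mass of the other coupling. Asking for mass at most 1 admits the walk
    measure of an isolated vertex, whose mass is [p]. *)
Lemma W1_tensor (mu1 mu2 : VG -> R) (nu1 nu2 : VH -> R) :
  \esum_(v in setT) (mu1 v)%:E <= 1 -> \esum_(w in setT) (nu1 w)%:E <= 1 ->
  W1 G mu1 mu2 \is a fin_num -> W1 H nu1 nu2 \is a fin_num ->
  W1 (cart G H) (fun u => mu1 u.1 * nu1 u.2)%R (fun u => mu2 u.1 * nu2 u.2)%R
    <= W1 G mu1 mu2 + W1 H nu1 nu2.
Proof.
move=> mu_le1 nu_le1 fmu fnu; apply/lee_addgt0Pr => e e0.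
have e20 : (0 < e / 2)%R by rewrite divr_gt0.
have [pi1 c1 lt1] := W1_approx fmu e20.
have [pi2 c2 lt2] := W1_approx fnu e20.
have p1 := coupling_ge0 c1; have p2 := coupling_ge0 c2.
have p1E v w : 0 <= (pi1 v w)%:E by rewrite lee_fin.
have p2E v w : 0 <= (pi2 v w)%:E by rewrite lee_fin.
have [b1 row1 col1] := c1; have [b2 row2 col2] := c2.
pose pi (v w : VG * VH) := (pi1 v.1 w.1 * pi2 v.2 w.2)%R.
apply: (@le_trans _ _ (transport_cost (cart G H) pi)).
  apply: W1_le_cost; split=> [v w|v|w].
  - have /andP[? ?] := b1 v.1 w.1; have /andP[? ?] := b2 v.2 w.2.
    by rewrite /pi mulr_ge0//= mulr_ile1.
  - by rewrite EFinM row1 row2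
      -(@esumM _ _ _ (fun w => (pi1 v.1 w)%:E)
                       (fun w => (pi2 v.2 w)%:E))//.
  - by rewrite EFinM col1 col2
      -(@esumM _ _ _ (fun v => (pi1 v w.1)%:E)
                       (fun v => (pi2 v w.2)%:E))//.
have mass (V : choiceType) (m1 m2 : V -> R) q :
    coupling m1 m2 q -> \esum_(v in setT) (m1 v)%:E <= 1 ->
    \esum_(v in setT) \esum_(w in setT) (q v w)%:E <= 1.
  by move=> [_ row _] le1; under eq_esum do rewrite -row.
have -> : transport_cost (cart G H) pi =
   transport_cost G pi1 * (\esum_(v in setT) \esum_(w in setT) (pi2 v w)%:E) +
   (\esum_(v in setT) \esum_(w in setT) (pi1 v w)%:E) * transport_cost H pi2.
  have d10 v w : 0 <= dist G R v w * (pi1 v w)%:E by rewrite mule_ge0 ?dist_ge0.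
  have d20 v w : 0 <= dist H R v w * (pi2 v w)%:E by rewrite mule_ge0 ?dist_ge0.
  rewrite /transport_cost -!esumM; try by move=> *; exact: esum_ge0.
  rewrite -esumD; try by move=> *; rewrite mule_ge0//; exact: esum_ge0.
  apply: eq_esum => v _.
  rewrite -!esumM//.
  rewrite -esumD; try by move=> *; rewrite mule_ge0.
  apply: eq_esum => w _.
  rewrite dist_cart /pi EFinM ge0_muleDl ?dist_ge0//.
  by rewrite (muleA (dist G R _ _)) (muleCA (dist H R _ _)).
have m1_le1 := mass _ _ _ _ c1 mu_le1; have m2_le1 := mass _ _ _ _ c2 nu_le1.
have T1_ge0 := transport_cost_ge0 G p1; have T2_ge0 := transport_cost_ge0 H p2.
have -> : W1 G mu1 mu2 + W1 H nu1 nu2 + e%:E =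
    (W1 G mu1 mu2 + (e / 2)%:E) + (W1 H nu1 nu2 + (e / 2)%:E).
  by rewrite addeACA -EFinD -splitr.
apply: leeD.
- by apply: le_trans (ltW lt1); rewrite -[leRHS]mule1 lee_wpmul2l.
- by apply: le_trans (ltW lt2); rewrite -[leRHS]mul1e lee_wpmul2r.
Qed.

End CartesianProduct.

(** * The lazy random walk measures [mu] *)

Section RandomWalkMeasure.
Local Open Scope ereal_scope.
Variables (R : realType) (V : choiceType) (G : graph V).

Lemma mu_ge0 (p : R) x v : (0 <= p <= 1)%R -> (0 <= mu G p x v)%R.
Proof.
move=> /andP[p0 p1]; rewrite /mu; case: ifP => // _; case: ifP => // _.
by rewrite divr_ge0 ?subr_ge0.
Qed.

Lemma degree_gt0 x v : adj G x v -> (0 < degree G x)%N.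
Proof.
move=> xv; rewrite /degree cardfs_gt0; apply/fset0Pn; exists v.
by rewrite in_fset_set ?inE//; exact: adj_finite.
Qed.

Lemma mu_le1 (p : R) x v : (0 <= p <= 1)%R -> (mu G p x v <= 1)%R.
Proof.
move=> /andP[p0 p1]; rewrite /mu; case: ifP => // _; case: ifP => // xv.
have d1 : (1 <= (degree G x)%:R :> R)%R by rewrite ler1n (degree_gt0 xv).
rewrite ler_pdivrMr ?(lt_le_trans ltr01)//.
by rewrite mul1r (le_trans _ d1)// lerBlDr lerDl.
Qed.

Lemma sum_mu (p : R) x : (0 <= p <= 1)%R -> (0 < degree G x)%N ->
  \esum_(v in setT) (mu G p x v)%:E = 1.
Proof.
move=> /andP[p0 p1] dx.
have c0 : (0 <= (1 - p) / (degree G x)%:R :> R)%R by rewrite divr_ge0 ?subr_ge0.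
have -> : \esum_(v in setT) (mu G p x v)%:E =
    \esum_(v in setT) ((p * point_mass R x v)%:E +
      if v \in [set w | adj G x w]%classic
      then ((1 - p) / (degree G x)%:R)%:E else 0).
  apply: eq_esum => v _; rewrite /mu /point_mass; have [->|vx] := eqVneq v x.
    by rewrite mulr1 memNset ?adde0//= adj_irr.
  rewrite mulr0 add0e; case: ifPn => xv; first by rewrite mem_set.
  by rewrite memNset//; exact/negP.
rewrite esumD.
- rewrite esum_point_massZ// -esum_mkcond esum_fset//; last exact: adj_finite.
  rewrite fsbig_finite/=; last exact: adj_finite.
  rewrite sumEFin big_const_seq count_predT iter_addr_0 -/(degree G x).
  rewrite -(mulr_natr (_ / _)) divfK ?pnatr_eq0 -?lt0n//.
  by rewrite -EFinD addrC subrK.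
- by move=> v _; rewrite lee_fin mulr_ge0 ?point_mass_ge0.
- by move=> v _; case: ifP; rewrite ?lee_fin.
Qed.

(** At an isolated vertex [mu G p x] is [p] times a point mass, hence dominated by the point
    mass. *)
Lemma sum_mu_le1 (p : R) x : (0 <= p <= 1)%R ->
  \esum_(v in setT) (mu G p x v)%:E <= 1.
Proof.
move=> p01; have [dx|dx] := ltnP 0%N (degree G x); first by rewrite sum_mu.
rewrite -[leRHS](sum_point_mass R x); apply: le_esum => v _.
rewrite lee_fin /mu /point_mass; have [_|_] := eqVneq v x.
  by case/andP: p01.
by case: ifP => // /degree_gt0; rewrite ltnNge dx.
Qed.

(** Off [x] the masses are proportional to the moving probability, so a lazier walk mixes the
    original one with staying put. *)
Lemma mu_lazy (a p q : R) x v : (1 - q = a * (1 - p))%R ->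
  mu G q x v = (a * mu G p x v + (1 - a) * point_mass R x v)%R.
Proof.
rewrite /mu /point_mass; case: ifP => [_|_] qE; first by rewrite mulr1; lra.
rewrite mulr0 addr0 qE; case: ifP => _; first by rewrite mulrA.
by rewrite mulr0.
Qed.

Lemma dist_triangle u v w : dist G R u w <= dist G R u v + dist G R v w.
Proof.
have Noo a b : dist G R a b != -oo.
  by rewrite gt_eqF// (lt_le_trans _ (dist_ge0 _ _ _ _)).
have [->|[s1 [p1 l1 ->]]] := dist_shortest_walk R G u v.
  by rewrite addye ?leey.
have [->|[s2 [p2 l2 ->]]] := dist_shortest_walk R G v w.
  by rewrite addey ?leey.
have := @dist_le_walk R _ G u (s1 ++ s2).
by rewrite cat_path last_cat l1 l2 p1 p2 size_cat natrD EFinD; apply.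
Qed.

Lemma dist_eq0 x1 x2 : dist G R x1 x2 = 0 -> x1 = x2.
Proof.
have [->//|[s [_ <- ->]]] := dist_shortest_walk R G x1 x2.
by case: s => //= a s [] /eqP; rewrite pnatr_eq0.
Qed.

Lemma dist_fin_degree x1 x2 : dist G R x1 x2 \is a fin_num ->
  x1 != x2 -> (0 < degree G x1)%N.
Proof.
have [->//|[s [ps <- _]]] := dist_shortest_walk R G x1 x2.
case: s ps => [|a s] /=; first by rewrite eqxx.
by move=> /andP[/degree_gt0].
Qed.

Lemma mu_supp (p : R) x v : mu G p x v != 0%R ->
  dist G R x v <= 1 /\ dist G R v x <= 1.
Proof.
rewrite /mu; have [->|_] := eqVneq v x; first by rewrite dist_refl.
case: ifP => [xv _|_]; last by rewrite eqxx.
split; first by apply: (@dist_le_walk R _ G x [:: v]); rewrite /= xv.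
by apply: (@dist_le_walk R _ G v [:: x]); rewrite /= adj_sym xv.
Qed.

Lemma W1_diag (m : V -> R) : (forall v, 0 <= m v <= 1)%R -> W1 G m m = 0.
Proof.
move=> m01; apply/eqP; rewrite eq_le W1_ge0 andbT.
pose pi v w := if w == v then m v else 0%R.
have m0 v : (0 <= m v)%R by case/andP: (m01 v).
have -> : 0 = transport_cost G pi.
  apply/esym; apply: esum1 => v _; apply: esum1 => w _; rewrite /pi.
  by case: eqP => [->|_]; rewrite ?dist_refl ?mul0e ?mule0.
apply: W1_le_cost; apply: coupling_intro.
- by move=> v w; rewrite /pi; case: ifP.
- by move=> v; case/andP: (m01 v).
- move=> v; rewrite (@esum_single _ _ _ v) /pi ?eqxx ?lee_fin//.
  by move=> w /negbTE->.
- move=> v; rewrite (@esum_single _ _ _ v) /pi ?eqxx ?lee_fin//.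
  by move=> w; rewrite eq_sym => /negbTE->.
Qed.

(** The independent coupling has total mass 1 and only moves mass between the unit balls around [x1]
    and [x2], so its cost is at most [1 + dist G R x1 x2 + 1]. Equal vertices are treated apart,
    since their degree may be zero. *)
Lemma W1_mu_fin D (p : R) x1 x2 : regular G D -> (0 <= p <= 1)%R ->
  dist G R x1 x2 \is a fin_num ->
  W1 G (mu G p x1) (mu G p x2) \is a fin_num.
Proof.
move=> regG p01 dfin.
have [<-|x12] := eqVneq x1 x2.
  by rewrite W1_diag// => v; rewrite mu_ge0 ?mu_le1.
have deg1 := dist_fin_degree dfin x12.
have deg2 : (0 < degree G x2)%N by rewrite (regG x2) -(regG x1).
have m0 x v := mu_ge0 x v p01.
have m0E x v : 0 <= (mu G p x v)%:E by rewrite lee_fin.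
pose pi v w := (mu G p x1 v * mu G p x2 w)%R.
have pi0 v w : (0 <= pi v w)%R by rewrite mulr_ge0.
rewrite ge0_fin_numE ?W1_ge0//.
apply: (@le_lt_trans _ _ (transport_cost G pi)).
  apply: W1_le_cost; apply: coupling_intro => //.
  - by move=> v; exact: mu_le1.
  - move=> v; under eq_esum do rewrite EFinM.
    by rewrite esumZl// sum_mu// mule1.
  - move=> w; under eq_esum do rewrite /pi mulrC EFinM.
    by rewrite esumZl// sum_mu// mule1.
pose C := 1 + dist G R x1 x2 + 1.
have C0 : 0 <= C by rewrite !adde_ge0 ?dist_ge0.
apply: (@le_lt_trans _ _
  (\esum_(v in setT) \esum_(w in setT) (C * (pi v w)%:E))).
  apply: le_esum => v _; apply: le_esum => w _; rewrite /pi.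
  have [->|/mu_supp[_ vx1]] := eqVneq (mu G p x1 v) 0%R.
    by rewrite mul0r !mule0.
  have [->|/mu_supp[x2w _]] := eqVneq (mu G p x2 w) 0%R.
    by rewrite mulr0 !mule0.
  apply: lee_wpmul2r; first by rewrite lee_fin mulr_ge0.
  apply: le_trans (dist_triangle v x2 w) _; apply: leeD => //.
  by apply: le_trans (dist_triangle v x1 x2) _; apply: leeD.
under eq_esum => v _.
  rewrite esumZl//; last by move=> *; rewrite lee_fin.
  under eq_esum do rewrite EFinM.
  rewrite esumZl// sum_mu// mule1.
  over.
by rewrite esumZl// sum_mu// mule1 /C -(fineK dfin) -!EFinD ltry.
Qed.

(* The degenerate [D = 0] forces [a = 0] and [x1 = x2]. *)
Lemma W1_mu_lazy_ge D (p a b : R) x1 x2 : regular G D -> (2^-1 <= p <= 1)%R ->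
  dist G R x1 x2 \is a fin_num -> (0 <= a)%R -> (0 <= b)%R -> (a + b = 1)%R ->
  (a = 0%R <-> D = 0%N) ->
  b%:E * dist G R x1 x2 + a%:E * W1 G (mu G p x1) (mu G p x2) <=
  W1 G (fun v => a * mu G p x1 v + b * point_mass R x1 v)%R
       (fun v => a * mu G p x2 v + b * point_mass R x2 v)%R.
Proof.
move=> regG /andP[p_ge p_le1] dfin a0 b0 ab aD.
have p01 : (0 <= p <= 1)%R by rewrite (le_trans _ p_ge) ?invr_ge0.
have [D0|Dn0] := eqVneq D 0%N.
  have a_0 : a = 0%R by exact/aD.
  have [->|/(dist_fin_degree dfin)] := eqVneq x1 x2; last by rewrite regG D0.
  by rewrite dist_refl mule0 a_0 mul0e adde0 W1_ge0.
have agt0 : (0 < a)%R.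
  rewrite lt_neqAle a0 andbT eq_sym; apply/eqP => /aD /eqP.
  by rewrite (negbTE Dn0).
apply: W1_lazy => //.
- by move=> v; exact: mu_ge0.
- by move=> v; exact: mu_le1.
- by rewrite sum_mu// regG lt0n.
(* The two masses at the centers add up to [2 * p]; this is where [p >= 1/2] enters. *)
- by rewrite /mu !eqxx; lra.
Qed.

End RandomWalkMeasure.

(** * The Wasserstein distance between walk measures of the product *)

Section CartesianTransport.
Local Open Scope classical_set_scope.
Local Open Scope ereal_scope.
Variables (R : realType) (VG VH : choiceType) (G : graph VG) (H : graph VH).
Variables (DG DH : nat) (regG : regular G DG) (regH : regular H DH).
Hypothesis D_gt0 : (0 < DG + DH)%N.
(** [a] and [b] are the probabilities that a step of the simple random walk on the product moves in
    [G], respectively in [H]. *)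
Let a : R := DG%:R / (DG%:R + DH%:R).
Let b : R := DH%:R / (DG%:R + DH%:R).

Let Dn0 : (DG%:R + DH%:R != 0 :> R)%R.
Proof. by rewrite -natrD pnatr_eq0 -lt0n. Qed.
Let a0 : (0 <= a)%R. Proof. by rewrite divr_ge0 ?addr_ge0. Qed.
Let b0 : (0 <= b)%R. Proof. by rewrite divr_ge0 ?addr_ge0. Qed.
Let ab : (a + b = 1)%R. Proof. by rewrite -mulrDl divff. Qed.
Let aD : a = 0%R <-> DG = 0%N.
Proof.
split=> [/eqP|D0]; last by rewrite /a D0 mul0r.
by rewrite mulf_eq0 invr_eq0 (negbTE Dn0) orbF pnatr_eq0 => /eqP.
Qed.
Let bD : b = 0%R <-> DH = 0%N.
Proof.
split=> [/eqP|D0]; last by rewrite /b D0 mul0r.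
by rewrite mulf_eq0 invr_eq0 (negbTE Dn0) orbF pnatr_eq0 => /eqP.
Qed.

(** A neighbor in the [G] direction gets [(1 - p) / (DG + DH) = a * ((1 - p) / DG)], and likewise
    for [H]; the atom [p] at [(x, y)] splits as [a * p + b * p]. *)
Lemma mu_cart (p : R) x y : mu (cart G H) p (x, y) =
  (fun z => a * (mu G p x z.1 * point_mass R y z.2) +
            b * (point_mass R x z.1 * mu H p y z.2))%R.
Proof.
apply/funext => -[v w]; rewrite /mu /point_mass degree_cart /= regG regH.
rewrite xpair_eqE /cart_adj /=.
have [->|vx] := eqVneq v x.
  rewrite /= mul1r adj_irr orbF.
  have [_|wy] := eqVneq w y; first by rewrite mulr1 -mulrDl ab mul1r.
  rewrite !mulr0 add0r /=; case: ifP => yw; last by rewrite mulr0.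
  have := degree_gt0 yw; rewrite regH => DH_gt0.
  have DHn0 : (DH%:R != 0 :> R)%R by rewrite pnatr_eq0 -lt0n.
  by rewrite natrD /b; field; rewrite DHn0.
rewrite /= mul0r mulr0 addr0.
have [_|wy] := eqVneq w y; last first.
  by rewrite andbF !mulr0.
rewrite andbT mulr1; case: ifP => xv; last by rewrite mulr0.
have := degree_gt0 xv; rewrite regG => DG_gt0.
have DGn0 : (DG%:R != 0 :> R)%R by rewrite pnatr_eq0 -lt0n.
by rewrite natrD /a; field; rewrite DGn0.
Qed.

Lemma mu_cart_fst (p : R) x y v : (0 <= p <= 1)%R ->
  (a * mu G p x v + b * point_mass R x v)%:E =
  \esum_(z in fst @^-1` [set v]) (mu (cart G H) p (x, y) z)%:E.
Proof.
move=> p01.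
rewrite (@reindex_esum _ _ _ setT _ (fun w => (v, w))); last first.
  by split=> [w _ //|w w' _ _ []//|[v' w] /= ->]; exists w.
rewrite mu_cart /=.
under eq_esum do
  rewrite mulrA [(b * _)%R]mulrA EFinD [(b * _ * _)%:E]EFinM.
rewrite esumD; last 2 first.
- by move=> w _; rewrite lee_fin !mulr_ge0 ?mu_ge0 ?point_mass_ge0.
- by move=> w _; rewrite -EFinM lee_fin !mulr_ge0 ?mu_ge0 ?point_mass_ge0.
rewrite esum_point_massZ ?mulr_ge0 ?mu_ge0// EFinD; congr (_ + _).
(* When [DH = 0] the measure [mu H p y] may fail to have mass 1, but then its weight [b]
   vanishes. *)
have [DH0|DHn0] := eqVneq DH 0%N.
  have -> : b = 0%R by exact/bD.
  by rewrite !mul0r esum1// => w _; rewrite mul0e.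
rewrite esumZl ?sum_mu ?mule1 ?lee_fin ?mulr_ge0 ?point_mass_ge0//.
  by rewrite regH lt0n.
by move=> w; rewrite lee_fin mu_ge0.
Qed.

Lemma mu_cart_snd (p : R) x y w : (0 <= p <= 1)%R ->
  (b * mu H p y w + a * point_mass R y w)%:E =
  \esum_(z in snd @^-1` [set w]) (mu (cart G H) p (x, y) z)%:E.
Proof.
move=> p01.
rewrite (@reindex_esum _ _ _ setT _ (fun v => (v, w))); last first.
  by split=> [v _ //|v v' _ _ []//|[v w'] /= ->]; exists v.
rewrite mu_cart /= addrC.
under eq_esum do
  rewrite [(mu _ _ _ _ * _)%R]mulrC [(point_mass _ _ _ * mu _ _ _ _)%R]mulrC
    mulrA [(b * _)%R]mulrA EFinD [(a * _ * _)%:E]EFinM.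
rewrite esumD; last 2 first.
- by move=> v _; rewrite -EFinM lee_fin !mulr_ge0 ?mu_ge0 ?point_mass_ge0.
- by move=> v _; rewrite lee_fin !mulr_ge0 ?mu_ge0 ?point_mass_ge0.
rewrite esum_point_massZ ?mulr_ge0 ?mu_ge0// EFinD; congr (_ + _).
have [DG0|DGn0] := eqVneq DG 0%N.
  have -> : a = 0%R by exact/aD.
  by rewrite !mul0r esum1// => v _; rewrite mul0e.
rewrite esumZl ?sum_mu ?mule1 ?lee_fin ?mulr_ge0 ?point_mass_ge0//.
  by rewrite regG lt0n.
by move=> v; rewrite lee_fin mu_ge0.
Qed.

Lemma W1_cart (p : R) x1 x2 y1 y2 : (2^-1 <= p <= 1)%R ->
  dist G R x1 x2 \is a fin_num -> dist H R y1 y2 \is a fin_num ->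
  W1 (cart G H) (mu (cart G H) p (x1, y1)) (mu (cart G H) p (x2, y2)) =
  a%:E * (W1 G (mu G p x1) (mu G p x2) + dist H R y1 y2) +
  b%:E * (dist G R x1 x2 + W1 H (mu H p y1) (mu H p y2)).
Proof.
move=> p_ge dxfin dyfin.
have p01 : (0 <= p <= 1)%R.
  by case/andP: p_ge => p_ge ->; rewrite (le_trans _ p_ge) ?invr_ge0.
have Gfin := W1_mu_fin regG p01 dxfin; have Hfin := W1_mu_fin regH p01 dyfin.
have pm_ge0 := point_mass_ge0 R.
have pm_fin (V : choiceType) (K : graph V) u v : dist K R u v \is a fin_num ->
    W1 K (point_mass R u) (point_mass R v) \is a fin_num.
  move=> dfin; rewrite ge0_fin_numE ?W1_ge0//.
  by rewrite (le_lt_trans (W1_point_mass _ _ _ _))// ltey_eq dfin.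
have pmx_fin := pm_fin _ _ _ _ dxfin; have pmy_fin := pm_fin _ _ _ _ dyfin.
apply/eqP; rewrite eq_le; apply/andP; split.
  (* Upper bound: each of the two tensor terms is transported by a product coupling, whose
     point-mass factor costs at most a distance. *)
  rewrite !mu_cart.
  have tensorG : W1 (cart G H)
      (fun z => mu G p x1 z.1 * point_mass R y1 z.2)%R
      (fun z => mu G p x2 z.1 * point_mass R y2 z.2)%R <=
      W1 G (mu G p x1) (mu G p x2) + dist H R y1 y2.
    apply: le_trans (W1_tensor _ _ _ _) _ => //.
    - exact: sum_mu_le1.
    - by rewrite sum_point_mass.
    - by rewrite leeD2l// W1_point_mass.
  have tensorH : W1 (cart G H)
      (fun z => point_mass R x1 z.1 * mu H p y1 z.2)%R
      (fun z => point_mass R x2 z.1 * mu H p y2 z.2)%R <=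
      dist G R x1 x2 + W1 H (mu H p y1) (mu H p y2).
    apply: le_trans (W1_tensor _ _ _ _) _ => //.
    - by rewrite sum_point_mass.
    - exact: sum_mu_le1.
    - by rewrite leeD2r// W1_point_mass.
  apply: le_trans (W1_mix a0 b0 ab _ _) _.
  - rewrite ge0_fin_numE ?W1_ge0// (le_lt_trans tensorG)//.
    by rewrite ltey_eq fin_numD Gfin dyfin.
  - rewrite ge0_fin_numE ?W1_ge0// (le_lt_trans tensorH)//.
    by rewrite ltey_eq fin_numD Hfin dxfin.
  by apply: leeD; apply: lee_wpmul2l; rewrite ?lee_fin.
(* Lower bound: the cost of [pi] splits into a [G] part and an [H] part, each bounded below through
   its projection by the lazy estimate with weights [a], [b] in the two orders. *)
apply: le_W1 => pi pic; have pi0 := coupling_ge0 pic.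
have pi0E u v : 0 <= (pi u v)%:E by rewrite lee_fin.
have -> : transport_cost (cart G H) pi =
    \esum_(u in setT) \esum_(v in setT) (dist G R u.1 v.1 * (pi u v)%:E) +
    \esum_(u in setT) \esum_(v in setT) (dist H R u.2 v.2 * (pi u v)%:E).
  rewrite -esumD;
    try by move=> *; apply: esum_ge0 => *; rewrite mule_ge0 ?dist_ge0.
  apply: eq_esum => u _.
  rewrite -esumD; try by move=> *; rewrite mule_ge0 ?dist_ge0.
  by apply: eq_esum => v _; rewrite dist_cart ge0_muleDl ?dist_ge0.
have mix_le1 (c d s t : R) : (0 <= c -> 0 <= d -> c + d = 1 ->
    s <= 1 -> t <= 1 -> c * s + d * t <= 1)%R.
  by move=> c0 d0 cd s1 t1; rewrite -cd lerD// ler_piMr.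
have pm_le1 (V : choiceType) (u v : V) : (point_mass R u v <= 1)%R.
  by rewrite /point_mass lern1 leq_b1.
have ba : (b + a = 1)%R by rewrite addrC.
have lbG := W1_mu_lazy_ge regG p_ge dxfin a0 b0 ab aD.
have lbH := W1_mu_lazy_ge regH p_ge dyfin b0 a0 ba bD.
have pushG := @W1_push _ _ _ G fst _ _ _ _ pi pic
  (fun v => mix_le1 _ _ _ _ a0 b0 ab (mu_le1 G x1 v p01) (pm_le1 _ x1 v))
  (fun v => mu_cart_fst x1 y1 v p01) (fun v => mu_cart_fst x2 y2 v p01).
have pushH := @W1_push _ _ _ H snd _ _ _ _ pi pic
  (fun v => mix_le1 _ _ _ _ b0 a0 ba (mu_le1 H y1 v p01) (pm_le1 _ y1 v))
  (fun v => mu_cart_snd x1 y1 v p01) (fun v => mu_cart_snd x2 y2 v p01).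
apply: le_trans (leeD (le_trans lbG pushG) (le_trans lbH pushH)).
move: Gfin Hfin dxfin dyfin => /fineK <- /fineK <- /fineK <- /fineK <-.
rewrite -?(EFinD, EFinM) lee_fin le_eqVlt; apply/orP; left; apply/eqP.
by ring.
Qed.

End CartesianTransport.

(** * Dependence of the curvature on the laziness *)

Section Curvature.
Variables (R : realType) (V : choiceType) (G : graph V) (D : nat).
Hypothesis regG : regular G D.
Variables (x1 x2 : V).
Hypothesis dfin : dist G R x1 x2 \is a fin_num.
Let d : R := fine (dist G R x1 x2).

(** With the denominator cleared, the case [x1 = x2] is included: there [d] and the Wasserstein
    distance are both 0. *)
Lemma dist_kappa (p : R) : 0 <= p <= 1 ->
  d * kappa G p x1 x2 = d - fine (W1 G (mu G p x1) (mu G p x2)).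
Proof.
move=> p01; rewrite /kappa -/d; have [d0|dn0] := eqVneq d 0; last by field.
have x12 : x1 = x2 by apply: (@dist_eq0 R _ G); rewrite -(fineK dfin) -/d d0.
rewrite d0 mul0r x12 W1_diag ?subr0// => v.
by rewrite mu_ge0// mu_le1.
Qed.

(** Writing [mu G p] as a mixture of [mu G 2^-1] and a point mass, [W1_mix] and [W1_mu_lazy_ge] give
    matching bounds, so [W1 = b * d + a * W1] at [1/2]; subtracting from [d = (a + b) * d] leaves
    the factor [a]. *)
Lemma kappa_lazy (p : R) : x1 != x2 -> 2^-1 <= p < 1 ->
  kappa G p x1 x2 = 2 * (1 - p) * kappa G 2^-1 x1 x2.
Proof.
move=> x12 /andP[p_ge p_lt1].
have half01 : 0 <= (2^-1 : R) <= 1 by lra.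
have p01 : 0 <= p <= 1 by lra.
have dn0 : d != 0.
  apply: contra_neq x12 => d0; apply: (@dist_eq0 R _ G).
  by rewrite -(fineK dfin) -/d d0.
(* The value of [a] is forced by [mu_lazy], which asks for [1 - p = a * (1 - 2^-1)]. *)
pose a := 2 * (1 - p); pose b := 2 * p - 1.
have a0 : 0 < a by rewrite /a; lra.
have b0 : 0 <= b by rewrite /b; lra.
have ab : a + b = 1 by rewrite /a /b; lra.
have pE : 1 - p = a * (1 - 2^-1) by rewrite /a; field.
have muE x : mu G p x = fun v => a * mu G 2^-1 x v + b * point_mass R x v.
  apply/funext => v; rewrite (mu_lazy _ _ _ pE) (_ : 1 - a = b)//.
  by rewrite -ab addrC addKr.
have Wfin (q : R) : 0 <= q <= 1 -> W1 G (mu G q x1) (mu G q x2) \is a fin_num.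
  by move=> q01; exact: (W1_mu_fin regG q01 dfin).
have D_gt0 : (0 < D)%N by rewrite -(regG x1) (dist_fin_degree dfin x12).
have pm_fin : W1 G (point_mass R x1) (point_mass R x2) \is a fin_num.
  rewrite ge0_fin_numE ?W1_ge0// (le_lt_trans (W1_point_mass _ _ _ _))//.
  by rewrite ltey_eq dfin.
suff WE : fine (W1 G (mu G p x1) (mu G p x2)) =
    b * d + a * fine (W1 G (mu G 2^-1 x1) (mu G 2^-1 x2)).
  apply: (mulfI dn0); rewrite mulrCA !dist_kappa// WE -/a -[b](addKr a) ab.
  by ring.
apply: EFin_inj; rewrite EFinD 2!EFinM !fineK ?Wfin// muE (muE x2).
apply/eqP; rewrite eq_le; apply/andP; split.
  apply: le_trans (W1_mix (ltW a0) b0 ab (Wfin _ half01) pm_fin) _.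
  rewrite addeC; apply: leeD => //; apply: lee_wpmul2l; rewrite ?lee_fin//.
  exact: W1_point_mass.
apply: (W1_mu_lazy_ge regG _ dfin (ltW a0) b0 ab); first by lra.
by split=> [aE|DE]; move: a0 D_gt0; rewrite ?aE ?DE ?ltxx.
Qed.

(** By [kappa_lazy] the quotient under the limit is constant near 1 from the left. The factor [d]
    covers [x1 = x2], whatever value the limit then takes. *)
Lemma dist_kappaLLY : d * kappaLLY R G x1 x2 = 2 * (d * kappa G 2^-1 x1 x2).
Proof.
have [x12|x12] := eqVneq x1 x2.
  by rewrite /d x12 dist_refl /= !mul0r mulr0.
rewrite mulrCA; congr (_ * _); apply: lim_near_cst; first exact: norm_hausdorff.
near=> p.
have p_lt1 : p < 1 by near: p; exact: nbhs_left_lt.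
have p_ge : 2^-1 <= p by near: p; apply: nbhs_left_ge; lra.
rewrite kappa_lazy ?p_ge//; by field; lra.
Unshelve. all: by end_near.
Qed.

End Curvature.

(* The products [d * kappa] vanish when the two vertices coincide, since then
   [d = 0]. *)
Theorem theorem6p2 (R : realType) (VG VH : choiceType)
    (G : graph VG) (H : graph VH) (DG DH : nat)
    (regG : regular G DG) (regH : regular H DH)
    (x1 x2 : VG) (y1 y2 : VH)
    (dx_fin : dist G R x1 x2 \is a fin_num)
    (dy_fin : dist H R y1 y2 \is a fin_num)
    (neq : (x1, y1) <> (x2, y2)) :
  let dx : R := fine (dist G R x1 x2) in
  let dy : R := fine (dist H R y1 y2) in
  kappaLLY R (cart G H) (x1, y1) (x2, y2) =
    (DG%:R * dx * kappaLLY R G x1 x2 + DH%:R * dy * kappaLLY R H y1 y2)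
      / ((DG%:R + DH%:R) * (dx + dy))
  /\ forall p : R, 2^-1 <= p < 1 ->
    kappa (cart G H) p (x1, y1) (x2, y2) =
      (DG%:R * dx * kappa G p x1 x2 + DH%:R * dy * kappa H p y1 y2)
        / ((DG%:R + DH%:R) * (dx + dy)).
Proof.
move=> dx dy.
have xy12 : (x1, y1) != (x2, y2) by exact/eqP.
have regC : regular (cart G H) (DG + DH).
  by move=> u; rewrite degree_cart regG regH.
have dE : dist (cart G H) R (x1, y1) (x2, y2) = (dx + dy)%:E.
  by rewrite dist_cart EFinD !fineK.
have d_fin : dist (cart G H) R (x1, y1) (x2, y2) \is a fin_num by rewrite dE.
have dn0 : dx + dy != 0.
  apply: contra_neq xy12 => d0; apply: (@dist_eq0 R _ (cart G H)).
  by rewrite dE d0.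
(* Distinct vertices at finite distance are joined by a nonempty walk, so [(x1, y1)] has a
   neighbor. *)
have D_gt0 : (0 < DG + DH)%N.
  by rewrite -(regC (x1, y1)) (dist_fin_degree d_fin xy12).
have Dn0 : DG%:R + DH%:R != 0 :> R by rewrite -natrD pnatr_eq0 -lt0n.
(* Curvatures enter only multiplied by their distances, so that coinciding coordinates in one factor
   need no separate case. *)
have kappaE (p : R) : 2^-1 <= p < 1 ->
    (dx + dy) * kappa (cart G H) p (x1, y1) (x2, y2) =
    (DG%:R * (dx * kappa G p x1 x2) + DH%:R * (dy * kappa H p y1 y2))
      / (DG%:R + DH%:R).
  move=> p_half; have p01 : 0 <= p <= 1 by lra.
  have p_le1 : 2^-1 <= p <= 1 by lra.
  have Gfin := W1_mu_fin regG p01 dx_fin.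
  have Hfin := W1_mu_fin regH p01 dy_fin.
  have := dist_kappa d_fin p01; rewrite dE /= => ->.
  rewrite !dist_kappa// (W1_cart regG regH)//.
  rewrite -(fineK Gfin) -(fineK Hfin) -(fineK dx_fin) -(fineK dy_fin) /=.
  rewrite -/dx -/dy.
  by field.
split=> [|p p_half].
(* All three values of [kappaLLY] are twice the curvature at [1/2], which reduces this formula to
   [kappaE] at [p = 1/2]. *)
- apply: (mulfI dn0).
  have := dist_kappaLLY regC d_fin; rewrite dE /= => ->.
  rewrite kappaE; last by lra.
  have GE := dist_kappaLLY regG dx_fin; have HE := dist_kappaLLY regH dy_fin.
  rewrite -[DG%:R * dx * _]mulrA -[DH%:R * dy * _]mulrA GE HE.
  by rewrite -/dx -/dy; field; rewrite Dn0 dn0.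
- apply: (mulfI dn0); rewrite kappaE//.
  by field; rewrite Dn0 dn0.
Qed.
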